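(* Let $r_0>0$ and $0<L_0\le 1$ be constants and let $g$ be the charged Nariai metric $$ds^2=\frac{r_0^2}{L_0}\left(-\sin^2 r\,dt^2+dr^2\right)+r_0^2\left(d\theta^2+\sin^2\theta\, d\phi^2\right)$$ in coordinates $(x^1,x^2,x^3,x^4)=(t,r,\theta,\phi)$ (where $\sin r\ne0$ and $\sin\theta\neq0$). Let $T=\frac{c^4}{8\pi G}\left[S-\left(\frac{\kappa}{2}-\Lambda\right)g\right]$ be its energy-momentum tensor, with $\Lambda=\frac{1+L_0}{2r_0^2}$. Then: (i) the covariant derivative of $T$ vanishes, $\nabla T=0$; (ii) $T=\alpha\, e_1\otimes e_1+\beta\, e_2\otimes e_2+\gamma\, e_3\otimes e_3+\mu\, e_4\otimes e_4$ for $\alpha=-1$, $\beta=\frac1{L_0}$, $\gamma=\frac14$, $\mu=1$, and the $1$-forms (given by their components) $e_1=\left(\frac{\sqrt{3+L_0}}{4\sqrt{L_0}}\sin r,0,0,0\right)$, $e_2=\left(0,\frac{\sqrt{3+L_0}}{4},0,0\right)$, $e_3=\left(0,0,\sqrt{1+3L_0},0\right)$, $e_4=\left(0,0,0,\frac{\sqrt{1+3L_0}}{4}\sin\theta\right)$, with $\|e_1\|=-\frac{3+L_0}{16r_0^2}$, $\|e_2\|=\frac{L_0(3+L_0)}{16r_0^2}$, $\|e_3\|=\frac{1+3L_0}{r_0^2}$, $\|e_4\|=\frac{1+3L_0}{16r_0^2}$; (iii) $T$ is $R$-compatible, $C$-compatible and $P$-compatible.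
   Context: Here $\|e\|$ denotes $g^{ab}e_ae_b$; $c$, $G$, $\Lambda$ are the speed of light in vacuum, the gravitational constant and the cosmological constant. Conventions ($n=4$; $\nabla$ is the Levi-Civita connection). $R_{pqrs}$ is the Riemann curvature tensor, with the sign and index convention $R_{pqrs}=g(\mathcal R(\partial_p,\partial_q)\partial_s,\partial_r)$, where $\mathcal R(X,Y)Z=\nabla_X\nabla_YZ-\nabla_Y\nabla_XZ-\nabla_{[X,Y]}Z$; $S_{qr}=g^{ps}R_{pqrs}$ is the Ricci tensor and $\kappa=g^{qr}S_{qr}$. (For the metric above $S_{11}=\sin^2r$, $S_{22}=S_{33}=-1$, $S_{44}=-\sin^2\theta$, $\kappa=-\frac{2(1+L_0)}{r_0^2}$.) Define $C_{pqrs}=R_{pqrs}-\frac{1}{n-2}(g_{ps}S_{qr}-g_{qs}S_{pr}+S_{ps}g_{qr}-S_{qs}g_{pr})+\frac{\kappa}{(n-1)(n-2)}(g_{ps}g_{qr}-g_{qs}g_{pr})$ (conformal curvature) and $P_{pqrs}=R_{pqrs}-\frac{1}{n-1}(g_{ps}S_{qr}-g_{qs}S_{pr})$ (projective curvature). A symmetric $(0,2)$-tensor $\sigma$ is $B$-compatible, for a $(0,4)$-tensor $B$, if $\sigma^t_pB_{qrst}+\sigma^t_qB_{rpst}+\sigma^t_rB_{pqst}=0$, where $\sigma^t_p=g^{ts}\sigma_{sp}$.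
   Formalization: In (ii), as printed false for all c and G (the 11 and 33 components need different values of c^4/(8πG)), γ is 1/16 instead of 1/4, and the decomposition of T carries the factor c^4/(πG), with c, G > 0. *)

(* Defs.v *)
From mathcomp Require Import all_boot all_order all_algebra.
From mathcomp Require Import all_classical all_reals all_analysis.

Set Implicit Arguments.
Unset Strict Implicit.
Unset Printing Implicit Defensive.

Import Order.TTheory GRing.Theory Num.Theory.
Import numFieldNormedType.Exports.
Local Open Scope classical_set_scope.
Local Open Scope ring_scope.

(* Tensor calculus in one coordinate chart.  A point is the row vector of its
   n coordinates, and tensor fields are given by their components: a metric or
   a (0,2)-tensor field is a matrix-valued function of the point.  Indices are
   0-based: the coordinate x^i is entry i - 1 of the row. *)

Section TensorCalculus.
Context {R : realType} {n : nat}.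

Definition vfield := 'rV[R]_n -> 'rV[R]_n.
Definition form1 := 'rV[R]_n -> 'rV[R]_n.
Definition tensor2 := 'rV[R]_n -> 'M[R]_n.
Definition tensor4 := 'rV[R]_n -> 'I_n -> 'I_n -> 'I_n -> 'I_n -> R.

Definition pd (i : 'I_n) (f : 'rV[R]_n -> R) (x : 'rV[R]_n) : R :=
  'D_(delta_mx 0 i : 'rV[R]_n) f x.

Definition coordv (i : 'I_n) : vfield := fun _ => delta_mx 0 i.

Implicit Types (g sigma T : tensor2) (x : 'rV[R]_n) (X Y Z : vfield).

Definition ginv g : tensor2 := fun x => invmx (g x).

(* Gamma^a_{bc} *)
Definition christoffel g (a b c : 'I_n) x : R :=
  2^-1 * \sum_d ginv g x a d *
    (pd b (fun y => g y d c) x + pd c (fun y => g y d b) x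
     - pd d (fun y => g y b c) x).

(* nabla_X Y for the Levi-Civita connection. *)
Definition nabla g X Y : vfield := fun x => \row_a
  \sum_b X x 0 b * (pd b (fun y => Y y 0 a) x
                    + \sum_c christoffel g a b c x * Y x 0 c).

Definition bracket X Y : vfield := fun x => \row_a
  \sum_b (X x 0 b * pd b (fun y => Y y 0 a) x
          - Y x 0 b * pd b (fun y => X y 0 a) x).

Definition curvature_op g X Y Z : vfield := fun x =>
  nabla g X (nabla g Y Z) x - nabla g Y (nabla g X Z) x
  - nabla g (bracket X Y) Z x.

Definition inner g (u v : 'rV[R]_n) x : R := (u *m g x *m v^T) 0 0.

(* The last two indices are exchanged: R_{pqrs} = g(R(d_p, d_q) d_s, d_r),
   so that the unit sphere has S = - (n - 1) g. *)
Definition riemann g : tensor4 := fun x p q r s =>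
  inner g (curvature_op g (coordv p) (coordv q) (coordv s) x) (coordv r x) x.

Definition ricci g : tensor2 := fun x => \matrix_(q, r)
  \sum_p \sum_s ginv g x p s * riemann g x p q r s.

Definition scalar_curvature g x : R :=
  \sum_q \sum_r ginv g x q r * ricci g x q r.

Definition conformal g : tensor4 := fun x p q r s =>
  let h := g x in let S := ricci g x in
  riemann g x p q r s
  - (n%:R - 2)^-1 * (h p s * S q r - h q s * S p r
                     + S p s * h q r - S q s * h p r)
  + scalar_curvature g x / ((n%:R - 1) * (n%:R - 2))
    * (h p s * h q r - h q s * h p r).

Definition projective g : tensor4 := fun x p q r s =>
  let h := g x in let S := ricci g x in
  riemann g x p q r s - (n%:R - 1)^-1 * (h p s * S q r - h q s * S p r).

(* (nabla_m T)_{pq} *)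
Definition nabla2 g T x (m p q : 'I_n) : R :=
  pd m (fun y => T y p q) x
  - \sum_a christoffel g a m p x * T x a q
  - \sum_a christoffel g a m q x * T x p a.

(* sigma^t_p = g^{ts} sigma_{sp} *)
Definition raise g sigma x (t p : 'I_n) : R :=
  \sum_s ginv g x t s * sigma x s p.

Definition compatible g sigma (B : tensor4) (U : set 'rV[R]_n) : Prop :=
  forall x, U x ->
    (forall p q, sigma x p q = sigma x q p) /\
    forall p q r s,
      \sum_t (raise g sigma x t p * B x q r s t
              + raise g sigma x t q * B x r p s t
              + raise g sigma x t r * B x p q s t) = 0.

(* ||e|| = g^{ab} e_a e_b; no square root is taken, so it may be negative. *)
Definition form_norm g (e : form1) x : R :=
  \sum_a \sum_b ginv g x a b * e x 0 a * e x 0 b.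

Definition tens (e f : form1) : tensor2 := fun x => (e x)^T *m f x.

Definition energy_momentum (c G Lambda : R) g : tensor2 := fun x =>
  (c ^+ 4 / (8 * pi * G)) *:
    (ricci g x - (scalar_curvature g x / 2 - Lambda) *: g x).

End TensorCalculus.

Arguments vfield : clear implicits.
Arguments form1 : clear implicits.
Arguments tensor2 : clear implicits.
Arguments tensor4 : clear implicits.

Section ChargedNariai.
Context {R : realType}.

Definition row4 (a b c d : R) : 'rV[R]_4 := \row_i [:: a; b; c; d]`_i.

(* Coordinates are ordered (t, r, theta, phi). *)
Definition coord_r (x : 'rV[R]_4) : R := x 0 (inord 1).
Definition coord_theta (x : 'rV[R]_4) : R := x 0 (inord 2).

Definition charged_nariai (r0 L0 : R) : tensor2 R 4 := fun x =>
  diag_mx (row4 (r0 ^+ 2 / L0 * - sin (coord_r x) ^+ 2) (r0 ^+ 2 / L0)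
                (r0 ^+ 2) (r0 ^+ 2 * sin (coord_theta x) ^+ 2)).

Definition nariai_domain : set ('rV[R]_4) :=
  [set x | sin (coord_r x) != 0 /\ sin (coord_theta x) != 0].

Definition nariai_e1 (L0 : R) : form1 R 4 := fun x =>
  row4 (Num.sqrt (3 + L0) / (4 * Num.sqrt L0) * sin (coord_r x)) 0 0 0.
Definition nariai_e2 (L0 : R) : form1 R 4 := fun _ =>
  row4 0 (Num.sqrt (3 + L0) / 4) 0 0.
Definition nariai_e3 (L0 : R) : form1 R 4 := fun _ =>
  row4 0 0 (Num.sqrt (1 + 3 * L0)) 0.
Definition nariai_e4 (L0 : R) : form1 R 4 := fun x =>
  row4 0 0 0 (Num.sqrt (1 + 3 * L0) / 4 * sin (coord_theta x)).

End ChargedNariai.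

(* Main.v *)
Require Import Defs.
From mathcomp Require Import all_boot all_order all_algebra.
From mathcomp Require Import all_classical all_reals all_analysis.
From mathcomp Require Import ring lra.

Set Implicit Arguments.
Unset Strict Implicit.
Unset Printing Implicit Defensive.

Import Order.TTheory GRing.Theory Num.Theory.
Import numFieldNormedType.Exports.
Local Open Scope ring_scope.

(** The metric is a product: r0^2/L0 times the constant curvature Lorentzian
    surface h1 = - sin^2 r dt^2 + dr^2, plus r0^2 times the unit sphere
    h2 = dtheta^2 + sin^2 theta dphi^2.  Write [product_metric a b] for
    a h1 + b h2.  Scaling a factor by a constant changes neither the Levi-Civita
    connection of a product nor its Ricci tensor, so for all nonzero a and b the
    Christoffel symbols are the same table [product_christoffel], and, in the
    sign convention used here,
      Riem = - a (h1 /\ h1) - b (h2 /\ h2),   Ric = - h1 - h2,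
    where (A /\ B)_{pqrs} = A_{ps} B_{qr} - A_{qs} B_{pr} ([wedge]).

    Hence the energy-momentum tensor is again a combination of h1 and h2 with
    constant coefficients ([energy_momentum_nariai]).  The two factor metrics are
    parallel, which gives the vanishing of its covariant derivative
    ([nabla2_product_metric]), and both are diagonal in these coordinates, which
    reduces the decomposition into squares of 1-forms to a comparison of
    coefficients.

    Compatibility is algebraic.  Contracting sigma with A /\ B leaves, up to the
    sign of the cyclic order, the products M_{pq} B_{rs} with M = A g^-1 sigma;
    if M is symmetric, these cancel in pairs in the cyclic sum
    ([compatible_wedge]).  The Riemann tensor above and all the correction terms
    of the conformal and projective tensors are such wedges, and every M that
    occurs is a product of diagonal matrices. *)

(** * Coordinate formulas for the connection and the curvature *)

Section TensorCalculus.
Local Open Scope classical_set_scope.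
Context {R : realType} {n : nat}.
Implicit Types (g : tensor2 R n) (x : 'rV[R]_n).

Lemma near_eq_pd i (f h : 'rV[R]_n -> R) x :
  (\near x, f x = h x) -> pd i f x = pd i h x.
Proof. exact: near_eq_derive. Qed.

Lemma pd_cst i (a : R) x : pd i (fun=> a) x = 0.
Proof. exact: derive_cst. Qed.

(** The difference quotients agree before passing to the limit: those of a
    function of the single coordinate [j] vanish along another coordinate, and
    along [j] they are the one-variable quotients. *)
Lemma pd_coord i j (f : R -> R) x :
  pd i (fun y => f (y 0 j)) x = if i == j then f^`() (x 0 j) else 0.
Proof.
case: eqVneq => [->|ij].
  rewrite derive1E /pd /derive.
  apply: (congr1 (fun F : R -> R => lim (F @ 0^'))); apply/funext => t /=.
  by rewrite !mxE !eqxx /= [t%:A]mulr1 mulr1.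
rewrite -(pd_cst i (f (x 0 j)) x) /pd /derive.
apply: (congr1 (fun F : R -> R => lim (F @ 0^'))).
by apply/funext => t /=; rewrite !mxE eqxx eq_sym (negbTE ij) /= mulr0 add0r.
Qed.

Lemma nabla_coordv g p (Y : vfield R n) x a :
  nabla g (coordv p) Y x 0 a
  = pd p (fun y => Y y 0 a) x + \sum_c christoffel g a p c x * Y x 0 c.
Proof.
rewrite mxE (bigD1 p) //= mxE !eqxx mul1r [X in _ + X]big1 ?addr0 // => b bp.
by rewrite mxE eqxx (negbTE bp) mul0r.
Qed.

Lemma nabla_coordv_coordv g q s y a :
  nabla g (coordv q) (coordv s) y 0 a = christoffel g a q s y.
Proof.
rewrite nabla_coordv /coordv pd_cst add0r.
rewrite (bigD1 s) //= mxE !eqxx mulr1 big1 ?addr0 // => c cs.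
by rewrite mxE eqxx (negbTE cs) mulr0.
Qed.

Lemma nabla_bracket_coordv g p q Z x :
  nabla g (bracket (coordv p) (coordv q)) Z x = 0.
Proof.
apply/rowP => a; rewrite !mxE big1 // => b _; rewrite mxE big1 ?mul0r // => c _.
by rewrite /coordv !pd_cst !mulr0 subrr.
Qed.

(** The classical coordinate formula: coordinate fields commute, so the bracket
    term of the curvature operator drops out. *)
Lemma riemannE g x p q r s :
  riemann g x p q r s = \sum_a
    (pd p (christoffel g a q s) x - pd q (christoffel g a p s) x
     + \sum_c (christoffel g a p c x * christoffel g c q s x
               - christoffel g a q c x * christoffel g c p s x)) * g x a r.
Proof.
rewrite /riemann /inner /coordv trmx_delta -colE !mxE.
apply: eq_bigr => a _; congr (_ * _); rewrite /curvature_op nabla_bracket_coordv subr0.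
have mxB (u v : 'rV[R]_n) : (u - v) 0 a = u 0 a - v 0 a by rewrite !mxE.
rewrite mxB !nabla_coordv.
have E u v : (fun y => nabla g (coordv u) (coordv v) y 0 a) = christoffel g a u v.
  by apply/funext => y; rewrite nabla_coordv_coordv.
rewrite !E sumrB addrACA opprD; congr (_ + _ + (_ - _));
  by apply: eq_bigr => c _; rewrite nabla_coordv_coordv.
Qed.

End TensorCalculus.

(** * Compatibility with sums of wedges *)

Section Compatibility.
Context {R : realType} {n : nat}.
Implicit Types (g sigma : tensor2 R n) (x : 'rV[R]_n) (B : tensor4 R n).
Implicit Types (U : set 'rV[R]_n).

Definition wedge (A1 A2 : 'M[R]_n) p q r s : R := A1 p s * A2 q r - A1 q s * A2 p r.

Lemma raiseE g sigma x t p : raise g sigma x t p = (ginv g x *m sigma x) t p.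
Proof. by rewrite mxE. Qed.

(** The contraction of [sigma] with the wedge is M_{qp} B_{rs} - M_{rp} B_{qs},
    where M = A1 g^-1 sigma and B = A2.  In the cyclic sum each B_{ij} comes twice,
    with coefficients M_{kl} and - M_{lk}. *)
Lemma compatible_wedge g sigma (A1 A2 : tensor2 R n) U :
  (forall x, U x -> (sigma x)^T = sigma x) ->
  (forall x, U x -> (A1 x *m ginv g x *m sigma x)^T = A1 x *m ginv g x *m sigma x) ->
  compatible g sigma (fun x => wedge (A1 x) (A2 x)) U.
Proof.
move=> sym_sigma symM x Ux; split=> [p q|p q r s].
  by rewrite -[in LHS]sym_sigma // mxE.
pose M := A1 x *m ginv g x *m sigma x.
have trM i j : M i j = M j i by rewrite -[M in LHS](symM x Ux) [LHS]mxE.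
have contract i j k :
    \sum_t raise g sigma x t i * wedge (A1 x) (A2 x) j k s t
    = M j i * A2 x k s - M k i * A2 x j s.
  rewrite /M -mulmxA [(A1 x *m _) j i]mxE [(A1 x *m _) k i]mxE !mulr_suml -sumrB.
  by apply: eq_bigr => t _; rewrite -raiseE /wedge; ring.
by rewrite !big_split /= !contract (trM q p) (trM r p) (trM r q); ring.
Qed.

Lemma compatibleD g sigma B1 B2 U :
  compatible g sigma B1 U -> compatible g sigma B2 U ->
  compatible g sigma (fun x p q r s => B1 x p q r s + B2 x p q r s) U.
Proof.
move=> c1 c2 x Ux; split=> [|p q r s]; first by case: (c1 x Ux).
have [[_ c1x] [_ c2x]] := (c1 x Ux, c2 x Ux).
apply: etrans (etrans (congr2 +%R (c1x p q r s) (c2x p q r s)) (addr0 0)).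
by rewrite -big_split /=; apply: eq_bigr => t _; ring.
Qed.

Lemma compatibleZ g sigma (a : 'rV[R]_n -> R) B U :
  compatible g sigma B U ->
  compatible g sigma (fun x p q r s => a x * B x p q r s) U.
Proof.
move=> c x Ux; have [sym cx] := c x Ux; split=> // p q r s.
apply: etrans (etrans (congr1 ( *%R (a x)) (cx p q r s)) (mulr0 _)).
by rewrite mulr_sumr; apply: eq_bigr => t _; ring.
Qed.

Lemma eq_compatible g sigma1 sigma2 (B1 B2 : tensor4 R n) U :
  (forall x, U x -> sigma1 x = sigma2 x) ->
  (forall x, U x -> forall p q r s, B1 x p q r s = B2 x p q r s) ->
  compatible g sigma1 B1 U -> compatible g sigma2 B2 U.
Proof.
move=> eqs eqB c x Ux; have [sym cx] := c x Ux; split=> [p q|p q r s].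
  by rewrite -eqs.
apply: etrans (cx p q r s); apply: eq_bigr => t _.
by rewrite /raise eqs // !eqB.
Qed.

Section Metric.
Context (g sigma : tensor2 R n) (U : set 'rV[R]_n).
Context (g_unit : forall x, U x -> g x \in unitmx).
Context (sigma_sym : forall x, U x -> (sigma x)^T = sigma x).

Lemma compatible_wedge_metric (A : tensor2 R n) :
  compatible g sigma (fun x => wedge (g x) (A x)) U.
Proof.
apply: compatible_wedge => // x Ux.
by rewrite mulmxV ?g_unit // mul1mx sigma_sym.
Qed.

(** The correction term is the wedge of g with the Ricci tensor, and
    g g^-1 sigma = sigma is symmetric. *)
Lemma compatible_projective :
  compatible g sigma (riemann g) U -> compatible g sigma (projective g) U.
Proof.
move=> cR.
pose k : 'rV[R]_n -> R := fun=> - (n%:R - 1)^-1.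
have cS := compatibleZ k (compatible_wedge_metric (ricci g)).
apply: eq_compatible (compatibleD cR cS) => // x Ux p q r s.
by rewrite /projective /wedge /k; ring.
Qed.

(** As both tensors are symmetric, this says that sigma and the Ricci tensor
    commute as endomorphisms of the tangent space. *)
Context (ricci_comm : forall x, U x ->
  (ricci g x *m ginv g x *m sigma x)^T = ricci g x *m ginv g x *m sigma x).

(** Among the correction terms only the wedge of the Ricci tensor with g, in this
    order, does not have g as its left factor; it is the one that needs the
    commutation hypothesis. *)
Lemma compatible_conformal :
  compatible g sigma (riemann g) U -> compatible g sigma (conformal g) U.
Proof.
move=> cR.
pose k : 'rV[R]_n -> R := fun=> - (n%:R - 2)^-1.
pose k' x := scalar_curvature g x / ((n%:R - 1) * (n%:R - 2)).
have cgS := compatible_wedge_metric (ricci g).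
have cSg : compatible g sigma (fun x => wedge (ricci g x) (g x)) U.
  exact: compatible_wedge.
have cgg := compatible_wedge_metric g.
apply: eq_compatible
  (compatibleD (compatibleD cR (compatibleZ k (compatibleD cgS cSg)))
               (compatibleZ k' cgg)) => // x Ux p q r s.
by rewrite /conformal /wedge /k /k'; ring.
Qed.

End Metric.

End Compatibility.

(** * Sums over four indices and diagonal matrices *)

Lemma ord4_ind (P : 'I_4 -> Prop) :
  P (@Ordinal 4 0 isT) -> P (@Ordinal 4 1 isT) -> P (@Ordinal 4 2 isT) ->
  P (@Ordinal 4 3 isT) -> forall i, P i.
Proof.
move=> P0 P1 P2 P3 [i lti]; case: i lti => [|[|[|[|//]]]] lti;
  by rewrite (bool_irrelevance lti isT).
Qed.

Lemma sum_ord4 (R : realType) (F : 'I_4 -> R) :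
  \sum_i F i = F (@Ordinal 4 0 isT) + F (@Ordinal 4 1 isT)
             + F (@Ordinal 4 2 isT) + F (@Ordinal 4 3 isT).
Proof.
rewrite !big_ord_recl big_ord0 addr0 !addrA.
by do 3?congr (_ + _); congr F; apply: val_inj.
Qed.

Lemma sum_diag_mx (R : realType) (n : nat) (d : 'rV[R]_n) (F : 'I_n -> 'I_n -> R) :
  \sum_p \sum_s diag_mx d p s * F p s = \sum_p d 0 p * F p p.
Proof.
apply: eq_bigr => p _; rewrite (bigD1 p) //= [X in _ + X]big1 ?addr0.
  by rewrite mxE eqxx mulr1n.
by move=> s sp; rewrite mxE eq_sym (negbTE sp) mulr0n mul0r.
Qed.

(** * The product of two surfaces of constant curvature *)

Section ProductMetric.
Context {R : realType}.
Implicit Types (x : 'rV[R]_4) (a b : R).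

Definition cot (t : R) := cos t / sin t.

Lemma derive1_sin2 (k t : R) :
  (fun u => k * sin u ^+ 2 : R)^`()%classic t = k * (2 * sin t * cos t).
Proof.
by rewrite derive1E (_ : (fun u => _) = k \*: (sin ^+ 2) :> (R -> R)) ?derive_val.
Qed.

Lemma is_derive_sincos (t : R) :
  is_derive t (1 : R) (fun u => sin u * cos u : R) (cos t ^+ 2 - sin t ^+ 2).
Proof.
apply: (@is_derive_eq _ _ _ (sin * cos : R -> R)).
by rewrite /GRing.scale /=; ring.
Qed.

Lemma derive1_cot (t : R) : sin t != 0 -> cot^`()%classic t = - 1 - cot t ^+ 2.
Proof.
move=> s0; have ds : is_derive t (1 : R) (fun u => (sin u)^-1 : R) (- (sin t) ^- 2 *: cos t).
  exact: is_deriveV.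
transitivity ('D_1 (cos * (fun u => (sin u)^-1) : R -> R) t); first exact: derive1E.
by rewrite derive_val /cot /GRing.scale /=; field.
Qed.

Definition product_metric (a b : R) : tensor2 R 4 := fun x =>
  diag_mx (row4 (- a * sin (coord_r x) ^+ 2) a b (b * sin (coord_theta x) ^+ 2)).

(** The connection is insensitive to the scales [a] and [b], which cancel in
    g^-1 dg as they are constant on each factor. *)
Definition product_christoffel x (i j k : 'I_4) : R :=
  match val i, val j, val k with
  | 0%N, 0%N, 1%N | 0%N, 1%N, 0%N => cot (coord_r x)
  | 1%N, 0%N, 0%N => sin (coord_r x) * cos (coord_r x)
  | 2%N, 3%N, 3%N => - (sin (coord_theta x) * cos (coord_theta x))
  | 3%N, 2%N, 3%N | 3%N, 3%N, 2%N => cot (coord_theta x)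
  | _, _, _ => 0
  end.

Definition d_product_metric (a b : R) x (m p q : 'I_4) : R :=
  match val m, val p, val q with
  | 1%N, 0%N, 0%N => - a * (2 * sin (coord_r x) * cos (coord_r x))
  | 2%N, 3%N, 3%N => b * (2 * sin (coord_theta x) * cos (coord_theta x))
  | _, _, _ => 0
  end.

Definition d_product_christoffel x (m i j k : 'I_4) : R :=
  match val m, val i, val j, val k with
  | 1%N, 0%N, 0%N, 1%N | 1%N, 0%N, 1%N, 0%N => - 1 - cot (coord_r x) ^+ 2
  | 1%N, 1%N, 0%N, 0%N => cos (coord_r x) ^+ 2 - sin (coord_r x) ^+ 2
  | 2%N, 2%N, 3%N, 3%N => sin (coord_theta x) ^+ 2 - cos (coord_theta x) ^+ 2
  | 2%N, 3%N, 2%N, 3%N | 2%N, 3%N, 3%N, 2%N => - 1 - cot (coord_theta x) ^+ 2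
  | _, _, _, _ => 0
  end.

Lemma pd_coord_r m (f : R -> R) x :
  pd m (fun y => f (coord_r y)) x = if val m == 1%N then f^`()%classic (coord_r x) else 0.
Proof. by rewrite /coord_r pd_coord -val_eqE /= inordK. Qed.

Lemma pd_coord_theta m (f : R -> R) x :
  pd m (fun y => f (coord_theta y)) x = if val m == 2%N then f^`()%classic (coord_theta x) else 0.
Proof. by rewrite /coord_theta pd_coord -val_eqE /= inordK. Qed.

Lemma pd_product_metric a b m p q x :
  pd m (fun y => product_metric a b y p q) x = d_product_metric a b x m p q.
Proof.
have [pq|pq] := eqVneq p q; last first.
  rewrite (_ : (fun y => _) = fun=> 0); last first.
    by apply/funext => y; rewrite !mxE (negbTE pq).
  rewrite pd_cst; move: p q pq; rewrite /d_product_metric.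
  by do 2!apply: ord4_ind => //=; case: (val m) => [|[|[|]]].
rewrite -{q}pq; move: p; apply: ord4_ind.
- rewrite (_ : (fun y => _) = fun y => - a * sin (coord_r y) ^+ 2); last first.
    by apply/funext => y; rewrite !mxE.
  rewrite (pd_coord_r m (fun u => - a * sin u ^+ 2)) derive1_sin2.
  by rewrite /d_product_metric; case: (val m) => [|[|[|]]].
- rewrite (_ : (fun y => _) = fun=> a); last by apply/funext => y; rewrite !mxE.
  by rewrite pd_cst /d_product_metric; case: (val m) => [|[|[|]]].
- rewrite (_ : (fun y => _) = fun=> b); last by apply/funext => y; rewrite !mxE.
  by rewrite pd_cst /d_product_metric; case: (val m) => [|[|[|]]].
- rewrite (_ : (fun y => _) = fun y => b * sin (coord_theta y) ^+ 2); last first.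
    by apply/funext => y; rewrite !mxE.
  rewrite (pd_coord_theta m (fun u => b * sin u ^+ 2)) derive1_sin2.
  by rewrite /d_product_metric; case: (val m) => [|[|[|]]].
Qed.

(** The derivative of the cotangent is used in the form - 1 - cot^2, so that the
    curvature computation becomes a rational identity without any trigonometric
    relation. *)
Lemma pd_product_christoffel m i j k x : nariai_domain x ->
  pd m (fun y => product_christoffel y i j k) x = d_product_christoffel x m i j k.
Proof.
case=> sr0 st0; have dsc := is_derive_sincos.
have dNsc t : (fun u => - (sin u * cos u) : R)^`()%classic t = sin t ^+ 2 - cos t ^+ 2.
  by rewrite derive1E; have := is_deriveN (dsc t) => -[_ ->]; rewrite opprB.
move: i j k; do 3!apply: ord4_ind; rewrite /product_christoffel /=; first
  [ rewrite pd_cst | rewrite (pd_coord_r m cot) derive1_cot //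
  | rewrite (pd_coord_r m (fun u => sin u * cos u)) derive1E derive_val
  | rewrite (pd_coord_theta m cot) derive1_cot //
  | rewrite (pd_coord_theta m (fun u => - (sin u * cos u))) dNsc ];
  by rewrite /d_product_christoffel /=; case: (val m) => [|[|[|]]].
Qed.

Lemma mulmx_diag_row4 (a1 a2 a3 a4 b1 b2 b3 b4 : R) :
  diag_mx (row4 a1 a2 a3 a4) *m diag_mx (row4 b1 b2 b3 b4) =
  diag_mx (row4 (a1 * b1) (a2 * b2) (a3 * b3) (a4 * b4)).
Proof.
rewrite mulmx_diag; congr diag_mx; apply/rowP; apply: ord4_ind; by rewrite !mxE.
Qed.

Lemma ginv_product_metric a b x : a != 0 -> b != 0 -> nariai_domain x ->
  ginv (product_metric a b) x =
  diag_mx (row4 (- a * sin (coord_r x) ^+ 2)^-1 a^-1 b^-1 (b * sin (coord_theta x) ^+ 2)^-1).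
Proof.
move=> a0 b0 [sr0 st0]; set D := (RHS).
have DG : D *m product_metric a b x = 1%:M.
  rewrite mulmx_diag_row4 !mulVf ?mulf_neq0 ?oppr_eq0 ?expf_neq0 //.
  by apply/matrixP => i j; rewrite !mxE; congr (_ *+ _); move: i j; apply: ord4_ind.
have [_ Gu] := mulmx1_unit DG.
by rewrite /ginv -[D]mulmx1 -(mulmxV Gu) mulmxA DG mul1mx.
Qed.

Lemma christoffel_product_metric a b i j k x : a != 0 -> b != 0 -> nariai_domain x ->
  christoffel (product_metric a b) i j k x = product_christoffel x i j k.
Proof.
move=> a0 b0 Ux; have [sr0 st0] := Ux; rewrite /christoffel ginv_product_metric //.
rewrite sum_ord4 !pd_product_metric.
move: i j k; do 3!apply: ord4_ind; rewrite !mxE /d_product_metric /product_christoffel /= /cot;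
  by field; rewrite ?a0 ?b0 ?sr0 ?st0.
Qed.

(** The two tensors may have different coefficients: the connection of
    [product_metric a b] is that of every other [product_metric], hence
    annihilates them all. *)
Lemma nabla2_product_metric a b a' b' m p q x : a != 0 -> b != 0 -> nariai_domain x ->
  nabla2 (product_metric a b) (product_metric a' b') x m p q = 0.
Proof.
move=> a0 b0 Ux; have [sr0 st0] := Ux; rewrite /nabla2 pd_product_metric !sum_ord4.
rewrite !christoffel_product_metric //.
move: m p q; do 3!apply: ord4_ind; rewrite !mxE /d_product_metric /product_christoffel /= /cot;
  by field; rewrite ?sr0 ?st0.
Qed.

Lemma open_nariai_domain : open (@nariai_domain R).
Proof.
have sin_open (i : 'I_4) : open [set x : 'rV[R]_4 | sin (x 0 i) != 0]%classic.
  have c : continuous (fun x : 'rV[R]_4 => sin (x 0 i)).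
    by move=> x; apply: continuous_comp; [exact: coord_continuous|exact: continuous_sin].
  move/continuousP : c => /(_ [set y | y != 0]%classic).
  by apply; exact: open_neq.
exact: (openI (sin_open (inord 1)) (sin_open (inord 2))).
Qed.

Lemma near_nariai_domain x : nariai_domain x -> \near x, nariai_domain x.
Proof. by move=> Ux; apply: open_nbhs_nbhs; split=> //; exact: open_nariai_domain. Qed.

(** Each factor contributes the curvature tensor of a surface of Gauss curvature
    1/a resp. 1/b, that is - (1/a) (a h1) /\ (a h1) for the first one. *)
Lemma riemann_product_metric a b x p q r s : a != 0 -> b != 0 -> nariai_domain x ->
  riemann (product_metric a b) x p q r s =
  - a * wedge (product_metric 1 0 x) (product_metric 1 0 x) p q r s
  - b * wedge (product_metric 0 1 x) (product_metric 0 1 x) p q r s.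
Proof.
move=> a0 b0 Ux; have [sr0 st0] := Ux; rewrite riemannE.
(* The closed form of the Christoffel symbols may be differentiated because it
   holds on the whole open domain, not only at x. *)
have pdc m i j k : pd m (christoffel (product_metric a b) i j k) x =
    d_product_christoffel x m i j k.
  rewrite -pd_product_christoffel //; apply: near_eq_pd.
  near=> y; apply: christoffel_product_metric => //; near: y; exact: near_nariai_domain.
rewrite (bigD1 r) //= [X in _ + X]big1 ?addr0; last first.
  by move=> i ir; rewrite !mxE (negbTE ir) mulr0n mulr0.
rewrite !pdc sum_ord4 !christoffel_product_metric //.
move: p q r s; do 2!apply: ord4_ind; do 2!apply: ord4_ind;
  rewrite /wedge !mxE /d_product_christoffel /product_christoffel /= ?mulr0n ?mulr1n /cot;
  by field; rewrite ?sr0 ?st0.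
Unshelve. all: by end_near. Qed.

(** A surface of Gauss curvature 1/a and metric a h1 has Ricci tensor h1, up to the
    sign convention: the scale cancels. *)
Lemma ricci_product_metric a b x : a != 0 -> b != 0 -> nariai_domain x ->
  ricci (product_metric a b) x = product_metric (-1) (-1) x.
Proof.
move=> a0 b0 Ux; have [sr0 st0] := Ux; apply/matrixP => q r; rewrite mxE.
rewrite ginv_product_metric // sum_diag_mx sum_ord4 !riemann_product_metric //.
move: q r; do 2!apply: ord4_ind;
  rewrite /wedge !mxE /= ?mulr0n ?mulr1n; by field; rewrite ?a0 ?b0 ?sr0 ?st0.
Qed.

Lemma scalar_curvature_product_metric a b x : a != 0 -> b != 0 -> nariai_domain x ->
  scalar_curvature (product_metric a b) x = - 2 / a - 2 / b.
Proof.
move=> a0 b0 Ux; have [sr0 st0] := Ux.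
rewrite /scalar_curvature ginv_product_metric // sum_diag_mx sum_ord4 ricci_product_metric //.
by rewrite !mxE /=; field; rewrite a0 b0 sr0 st0.
Qed.

Lemma product_metric_unit a b x : a != 0 -> b != 0 -> nariai_domain x ->
  product_metric a b x \in unitmx.
Proof.
move=> a0 b0 [sr0 st0]; rewrite unitmxE det_diag unitfE.
apply/prodf_neq0 => i _; move: i; apply: ord4_ind;
  by rewrite mxE //= mulf_neq0 ?oppr_eq0 ?expf_neq0.
Qed.

Lemma tr_product_metric a b x : (product_metric a b x)^T = product_metric a b x.
Proof. exact: tr_diag_mx. Qed.

Lemma tr_product_metric_ginv a b c d e f x : a != 0 -> b != 0 -> nariai_domain x ->
  let M := product_metric c d x *m ginv (product_metric a b) x
           *m product_metric e f x in
  M^T = M.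
Proof.
move=> a0 b0 Ux; rewrite ginv_product_metric // /product_metric.
by rewrite !mulmx_diag_row4 tr_diag_mx.
Qed.

Lemma compatible_riemann_product_metric a b c d : a != 0 -> b != 0 ->
  compatible (product_metric a b) (product_metric c d)
    (riemann (product_metric a b)) (@nariai_domain R).
Proof.
move=> a0 b0; have cw e f : compatible (product_metric a b) (product_metric c d)
    (fun x => wedge (product_metric e f x) (product_metric e f x)) (@nariai_domain R).
  by apply: compatible_wedge => x Ux; [exact: tr_product_metric|exact: tr_product_metric_ginv].
apply: eq_compatible (compatibleD (compatibleZ (fun=> - a) (cw 1 0))
                                  (compatibleZ (fun=> - b) (cw 0 1))) => // x Ux p q r s.
by rewrite riemann_product_metric // !mulNr.
Qed.

Lemma form_norm_product_metric a b (e : form1 R 4) x : a != 0 -> b != 0 -> nariai_domain x ->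
  form_norm (product_metric a b) e x =
  - (e x 0 (@Ordinal 4 0 isT)) ^+ 2 / (a * sin (coord_r x) ^+ 2)
  + (e x 0 (@Ordinal 4 1 isT)) ^+ 2 / a + (e x 0 (@Ordinal 4 2 isT)) ^+ 2 / b
  + (e x 0 (@Ordinal 4 3 isT)) ^+ 2 / (b * sin (coord_theta x) ^+ 2).
Proof.
move=> a0 b0 Ux; have [sr0 st0] := Ux; rewrite /form_norm ginv_product_metric //.
under eq_bigr do under eq_bigr do rewrite -mulrA.
rewrite sum_diag_mx sum_ord4 !mxE /=; field.
by rewrite a0 b0 sr0 st0.
Qed.

End ProductMetric.

(** * The charged Nariai metric *)

Section ChargedNariai.
Context {R : realType}.
Implicit Types (x : 'rV[R]_4).

Lemma charged_nariaiE (r0 L0 : R) :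
  charged_nariai r0 L0 = product_metric (r0 ^+ 2 / L0) (r0 ^+ 2).
Proof.
by apply/funext => x; rewrite /charged_nariai /product_metric; congr (diag_mx (row4 _ _ _ _)); ring.
Qed.

Lemma energy_momentum_nariai (r0 L0 c G : R) x :
  0 < r0 -> 0 < L0 -> 0 < G -> nariai_domain x ->
  energy_momentum c G ((1 + L0) / (2 * r0 ^+ 2)) (charged_nariai r0 L0) x =
  product_metric (c ^+ 4 / (pi * G) * ((3 + L0) / (16 * L0)))
        (c ^+ 4 / (pi * G) * ((1 + 3 * L0) / 16)) x.
Proof.
move=> /lt0r_neq0 r00 /lt0r_neq0 L00 /lt0r_neq0 G0 Ux.
have pi0 : pi != 0 :> R by rewrite lt0r_neq0 ?pi_gt0.
have a0 : r0 ^+ 2 / L0 != 0 by rewrite mulf_neq0 ?invr_eq0 ?expf_neq0.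
have b0 : r0 ^+ 2 != 0 by rewrite expf_neq0.
rewrite charged_nariaiE /energy_momentum ricci_product_metric //.
rewrite scalar_curvature_product_metric //.
(* Keeps [field] from unfolding the definition of pi. *)
move: (@pi R) pi0 => k k0.
apply/matrixP; do 2!apply: ord4_ind;
  rewrite !mxE /= ?mulr0n ?mulr1n; field; by rewrite ?r00 ?L00 ?G0 ?k0.
Qed.

End ChargedNariai.

Theorem theorem3p2 (R : realType) (r0 L0 c G : R)
    (r0_gt0 : 0 < r0) (L0_gt0 : 0 < L0) (L0_le1 : L0 <= 1)
    (c_gt0 : 0 < c) (G_gt0 : 0 < G) :
  let g := charged_nariai r0 L0 in
  let Lambda := (1 + L0) / (2 * r0 ^+ 2) in
  let T := energy_momentum c G Lambda g in
  let e1 := nariai_e1 L0 in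
  let e2 := nariai_e2 L0 in
  let e3 := nariai_e3 L0 in
  let e4 := nariai_e4 L0 in
  let alpha := -1 in
  let beta := L0^-1 in
  let gamma := 16^-1 in
  let mu := 1 in
  [/\ (* (i) *)
      forall x, nariai_domain x -> forall m p q, nabla2 g T x m p q = 0,
      (* (ii) *)
      forall x, nariai_domain x ->
        T x = (c ^+ 4 / (pi * G)) *:
          (alpha *: tens e1 e1 x + beta *: tens e2 e2 x
           + gamma *: tens e3 e3 x + mu *: tens e4 e4 x),
      forall x, nariai_domain x ->
        [/\ form_norm g e1 x = - ((3 + L0) / (16 * r0 ^+ 2)),
            form_norm g e2 x = L0 * (3 + L0) / (16 * r0 ^+ 2),
            form_norm g e3 x = (1 + 3 * L0) / r0 ^+ 2
          & form_norm g e4 x = (1 + 3 * L0) / (16 * r0 ^+ 2)]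
      (* (iii) *)
    & [/\ compatible g T (riemann g) nariai_domain,
          compatible g T (conformal g) nariai_domain
        & compatible g T (projective g) nariai_domain]].
Proof.
move=> g Lambda T e1 e2 e3 e4 alpha beta gamma mu.
have r00 := lt0r_neq0 r0_gt0; have L00 := lt0r_neq0 L0_gt0.
have a0 : r0 ^+ 2 / L0 != 0 by rewrite mulf_neq0 ?invr_eq0 ?expf_neq0.
have b0 : r0 ^+ 2 != 0 by rewrite expf_neq0.
set tau := c ^+ 4 / (pi * G).
pose T' := product_metric (tau * ((3 + L0) / (16 * L0))) (tau * ((1 + 3 * L0) / 16)).
have TE x : nariai_domain x -> T x = T' x by exact: energy_momentum_nariai.
have sqrt_sqr (u : R) : 0 < u -> Num.sqrt u ^+ 2 = u by move=> /ltW /sqr_sqrtr.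
have sq3 : Num.sqrt (3 + L0) ^+ 2 = 3 + L0 by apply: sqrt_sqr; lra.
have sq1 : Num.sqrt (1 + 3 * L0) ^+ 2 = 1 + 3 * L0 by apply: sqrt_sqr; lra.
have sqL := sqrt_sqr _ L0_gt0.
have sqL0 : Num.sqrt L0 != 0 by rewrite gt_eqF // sqrtr_gt0.
split.
- move=> x Ux m p q; rewrite -[RHS](@nabla2_product_metric R (r0 ^+ 2 / L0) (r0 ^+ 2)
    (tau * ((3 + L0) / (16 * L0))) (tau * ((1 + 3 * L0) / 16)) m p q x a0 b0 Ux).
  rewrite /nabla2 -charged_nariaiE TE //; congr (_ - _ - _).
  apply: near_eq_pd; near=> y; rewrite TE //; near: y; exact: near_nariai_domain.
- move=> x Ux; rewrite TE //; apply/matrixP; do 2!apply: ord4_ind;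
    rewrite !mxE !big_ord1 !mxE /= ?mulr0n ?mulr1n /alpha /beta /gamma /mu;
    by field: sqL sq3 sq1; rewrite ?r00 ?sqL0 ?L00.
- move=> x [sr0 st0]; rewrite /g charged_nariaiE.
  split; rewrite form_norm_product_metric // !mxE /=;
    by field: sqL sq3 sq1; rewrite ?r00 ?sqL0 ?L00 ?sr0 ?st0.
- have g_unit x : nariai_domain x -> g x \in unitmx.
    by move=> Ux; rewrite /g charged_nariaiE product_metric_unit.
  have T_sym x : nariai_domain x -> (T x)^T = T x by move=> Ux; rewrite TE // tr_product_metric.
  have cR : compatible g T (riemann g) nariai_domain.
    apply: (@eq_compatible _ _ _ T' T (riemann g)) => // [x Ux|]; first by rewrite TE.
    by rewrite /g charged_nariaiE; apply: compatible_riemann_product_metric.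
  split=> //; [apply: compatible_conformal => // | exact: compatible_projective].
  by move=> x Ux; rewrite TE // /g charged_nariaiE ricci_product_metric // tr_product_metric_ginv.
Unshelve. all: by end_near. Qed.
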